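(* Let $G=(V,E)$ be a computation graph with $n=|V|$ vertices and at least one edge, and let $M$ be the fast-memory size. Let $J^*_G$ be the minimum number of non-trivial I/Os over all valid evaluations of $G$. Let $L=D-A$ be the Laplacian of the underlying undirected unweighted graph of $G$, with eigenvalues $\lambda_1(L)\le\dots\le\lambda_n(L)$ in increasing order. Then for every integer $k$ with $1\le k\le n$, $$J^*_G \;\geq\; \frac{1}{\max_{v\in V} d_{out}(v)}\left\lfloor \frac{n}{k}\right\rfloor \sum_{i=1}^k \lambda_i(L) \;-\; 2kM,$$ where $d_{out}(v)$ is the out-degree of $v$ in $G$.
   Context: A computation graph is a finite directed acyclic graph $G=(V,E)$. Each vertex is an operation producing a single element, and an edge $(u,v)$ means the result of $u$ is an operand of $v$. Sources are the inputs and sinks are the outputs. Execution model: a single processor has a fast memory holding at most $M$ elements and an unbounded slow memory. Every vertex is evaluated exactly once (no recomputation), in an order that is topological with respect to $G$. To evaluate $v$, all parents of $v$ must be in fast memory; a parent not present must be read from slow memory. The eviction policy is unconstrained, but a value that is evicted while still needed by a later vertex must first be written to slow memory. Only non-trivial I/O is counted. Inputs can be placed directly into fast memory at no cost, and outputs are reported immediately at no cost when computed. However, an input that is evicted while still needed must be written to slow memory. Each transfer of one element between fast and slow memory counts as one I/O. $A$ is the adjacency matrix of the undirected graph obtained from $G$ by forgetting edge directions, and $D$ is its diagonal degree matrix. *)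

(* Defs.v *)
From HB Require Import structures.
From mathcomp Require Import all_boot all_order all_algebra.
Set Implicit Arguments. Unset Strict Implicit. Unset Printing Implicit Defensive.
Import Order.TTheory GRing.Theory Num.Theory.

(* [e u v] : directed edge (u,v), the result of u is an operand of v. *)
Definition acyclic (n : nat) (e : rel 'I_n) : Prop :=
  forall (x : 'I_n) (p : seq 'I_n), path e x p -> last x p = x -> p = [::].

Definition has_edge (n : nat) (e : rel 'I_n) : Prop :=
  exists u v, e u v.

Definition dout (n : nat) (e : rel 'I_n) (v : 'I_n) : nat := #|[set w | e v w]|.

Definition max_dout (n : nat) (e : rel 'I_n) : nat := \max_(v : 'I_n) dout e v.

Definition uadj (n : nat) (e : rel 'I_n) : rel 'I_n :=
  fun u v => (u != v) && (e u v || e v u).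

Definition udeg (n : nat) (e : rel 'I_n) (v : 'I_n) : nat := #|[set w | uadj e v w]|.

Local Open Scope ring_scope.
Definition laplacian (R : nzRingType) (n : nat) (e : rel 'I_n) : 'M[R]_n :=
  \matrix_(i, j) ((if i == j then (udeg e i)%:R else 0)
                  - (if uadj e i j then 1 else 0)).

Definition sorted_eigenvalues (R : rcfType) (n : nat) (A : 'M[R]_n)
  (lam : seq R) : Prop :=
  [/\ size lam = n, sorted <=%R lam &
      char_poly A = \prod_(x <- lam) ('X - x%:P)].

Local Close Scope ring_scope.

Inductive move (n : nat) : Type :=
| Compute of 'I_n
| Read of 'I_n
| Write of 'I_n
| Evict of 'I_n.

Record pstate (n : nat) := PState {
  fast : {set 'I_n}; slow : {set 'I_n}; done_ : {set 'I_n} }.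

Definition step (n : nat) (e : rel 'I_n) (M : nat) (s : pstate n)
  (m : move n) : option (pstate n) :=
  match m with
  | Compute v =>
      if (v \notin done_ s)
         && [forall u, e u v ==> (u \in fast s)]
         && (#|v |: fast s| <= M)
      then Some (PState (v |: fast s) (slow s) (v |: done_ s)) else None
  | Read v =>
      if (v \in slow s) && (#|v |: fast s| <= M)
      then Some (PState (v |: fast s) (slow s) (done_ s)) else None
  | Write v =>
      if v \in fast s
      then Some (PState (fast s) (v |: slow s) (done_ s)) else None
  | Evict v =>
      if v \in fast s
      then Some (PState (fast s :\ v) (slow s) (done_ s)) else None
  end.

Fixpoint run (n : nat) (e : rel 'I_n) (M : nat) (s : pstate n)
  (ms : seq (move n)) : option (pstate n) :=
  match ms with
  | [::] => Some s
  | m :: ms' => match step e M s m with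
                | Some s' => run e M s' ms'
                | None => None
                end
  end.

Definition init_state (n : nat) : pstate n := PState set0 set0 set0.

(* a valid evaluation: every move legal and at the end every vertex has been
   evaluated (each exactly once, by the [v \notin done_] guard) *)
Definition valid_evaluation (n : nat) (e : rel 'I_n) (M : nat)
  (ms : seq (move n)) : Prop :=
  exists s, run e M (init_state n) ms = Some s /\ done_ s = [set: 'I_n].

Definition is_io (n : nat) (m : move n) : bool :=
  match m with Read _ | Write _ => true | _ => false end.

Definition io_cost (n : nat) (ms : seq (move n)) : nat := count (@is_io n) ms.

(* Main.v *)
(** Cut the evaluation into [k] consecutive stretches, each computing a set [S]
of [q = n %/ k] vertices.  Every vertex outside [S] feeding [S] is in fast memory
when the stretch starts or is read during it; every vertex of [S] that feeds a
later vertex is in fast memory when the stretch ends or is written during it.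
So the stretch costs at least [boundary S - 2M], and [max_dout * boundary S]
bounds the number [1_S^T L 1_S] of edges leaving [S].  The vectors
[1_S / sqrt q] are orthonormal, hence by Ky Fan's inequality the quadratic forms
[1_S^T L 1_S] sum to at least [q] times the sum of the [k] smallest eigenvalues. *)

Require Import Defs.
From mathcomp Require Import all_boot all_order all_algebra.
From mathcomp Require Import perm spectral complex.
Set Implicit Arguments. Unset Strict Implicit.
Unset Printing Implicit Defensive.
Import Order.TTheory GRing.Theory Num.Theory.
Local Open Scope ring_scope.
Local Open Scope sesquilinear_scope.

(** * Ky Fan's inequality *)

Lemma sum_bool_lt (R : pzSemiRingType) (n k : nat) (F : nat -> R) :
  (k <= n)%N -> \sum_(i < n) F i * (i < k)%:R = \sum_(i < k) F i.
Proof.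
move=> le_kn; rewrite (big_ord_widen _ _ le_kn) [RHS]big_mkcond /=.
by apply: eq_bigr => i _; case: ifP; rewrite ?mulr1 ?mulr0.
Qed.

(** With weights in [[0, 1]] of total mass [k], the weighted sum is smallest when the [k] smallest
    values get weight 1. *)
Lemma sorted_weighted_sum (R : numDomainType) (lam : seq R) (k : nat)
  (w : 'I_(size lam) -> R) :
  sorted <=%R lam -> (k <= size lam)%N ->
  (forall i, 0 <= w i <= 1) -> \sum_i w i = k%:R ->
  \sum_(i < k) lam`_i <= \sum_(i < size lam) lam`_i * w i.
Proof.
move=> lam_sorted le_kn w01 sum_w.
have lam_le (i j : nat) : (i <= j)%N -> (j < size lam)%N -> lam`_i <= lam`_j.
  move=> le_ij lt_j; apply: (sorted_leq_nth le_trans lexx 0 lam_sorted) => //.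
  by rewrite inE (leq_ltn_trans le_ij).
have sum_lt : \sum_(i < size lam) (i < k)%:R = k%:R :> R.
  transitivity (\sum_(i < size lam) 1 * (i < k)%:R : R).
    by apply: eq_bigr => i _; rewrite mul1r.
  by rewrite (@sum_bool_lt _ _ _ (fun=> 1)) // sumr_const card_ord.
(* Both weightings have total mass k, so the values may be shifted by the
   threshold lam`_k.-1; then every term is nonnegative. *)
rewrite -subr_ge0 -(sum_bool_lt (nth 0 lam) le_kn) -sumrB.
have -> : \sum_(i < size lam) (lam`_i * w i - lam`_i * (i < k)%:R) =
          \sum_(i < size lam) (lam`_i - lam`_k.-1) * (w i - (i < k)%:R).
  under [RHS]eq_bigr do rewrite mulrBl.
  rewrite [RHS]sumrB -mulr_sumr [\sum_(i < size lam) (w i - _)]sumrB.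
  rewrite sum_w sum_lt subrr mulr0 subr0.
  by apply: eq_bigr => i _; rewrite mulrBr.
apply: sumr_ge0 => i _; have /andP[w_ge0 w_le1] := w01 i.
(* For [i < k] both factors are nonpositive, otherwise both are nonnegative. If [k = 0], only the
   second case occurs and [k.-1] is 0. *)
case: ltnP => [lt_ik | le_ki].
  apply: mulr_le0; rewrite subr_le0 //.
  by apply: lam_le; [rewrite -ltnS (ltn_predK lt_ik) | case: (k) lt_ik le_kn].
rewrite subr0; apply: mulr_ge0 => //; rewrite subr_ge0 lam_le //.
exact: leq_trans (leq_pred k) le_ki.
Qed.

Lemma char_poly_invmx_conj (F : fieldType) (n : nat) (P A : 'M[F]_n) :
  P \in unitmx -> char_poly (invmx P *m A *m P) = char_poly A.
Proof.
move=> P_unit; rewrite /char_poly.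
have PVP : map_mx polyC (invmx P) *m map_mx polyC P = 1%:M :> 'M[{poly F}]_n.
  by rewrite -map_mxM mulVmx // map_mx1.
have -> : char_poly_mx (invmx P *m A *m P) =
    map_mx polyC (invmx P) *m char_poly_mx A *m map_mx polyC P.
  rewrite /char_poly_mx mulmxBr mulmxBl !map_mxM; congr (_ - _).
  by rewrite scalar_mxC -mulmxA PVP mulmx1.
by rewrite !det_mulmx mulrAC -det_mulmx PVP det1 mul1r.
Qed.

(** These diagonal entries become the weights of [sorted_weighted_sum] once the rows are written in
    an eigenbasis. *)
Lemma unitary_gram_diag_le1 (C : numClosedFieldType) (k n : nat)
  (U : 'M[C]_(k, n)) (j : 'I_n) :
  U \is unitarymx -> 0 <= (U^t* *m U) j j <= 1.
Proof.
move=> /unitarymxP UU; set Q := U^t* *m U.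
have Qherm : Q^t* = Q by rewrite /Q trmx_mul map_mxM trmxCK.
have Qproj : Q *m Q^t* = Q.
  by rewrite Qherm /Q mulmxA -[_ *m U *m _]mulmxA UU mulmx1.
have QjjE : Q j j = \sum_l `|Q j l| ^+ 2.
  rewrite -{1}Qproj mxE; apply: eq_bigr => l _.
  by rewrite !mxE -normCK.
have Qjj_ge0 : 0 <= Q j j by rewrite QjjE sumr_ge0 // => l _; rewrite exprn_ge0.
rewrite Qjj_ge0 /=.
(* Q is an orthogonal projection, so Q j j is the squared norm of its row j. *)
have: Q j j ^+ 2 <= Q j j.
  rewrite {2}QjjE (bigD1 j) //= ger0_norm // lerDl sumr_ge0 // => l _.
  by rewrite exprn_ge0.
move: Qjj_ge0; rewrite le_eqVlt => /orP[/eqP <- | Qjj_gt0].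
  by rewrite ler01.
by rewrite expr2 -{3}[Q j j]mulr1 ler_pM2l.
Qed.

(** In an eigenbasis of [A] the trace is the sum of the eigenvalues weighted by the diagonal of
    [V^t* *m V], where [V] again has orthonormal rows. The weights lie in [[0, 1]] and add up to
    [k]. *)
Lemma ky_fan_normal (C : numClosedFieldType) (k n : nat) (A : 'M[C]_n)
  (lam : seq C) (U : 'M[C]_(k, n)) :
  A \is normalmx -> sorted <=%R lam ->
  char_poly A = \prod_(x <- lam) ('X - x%:P) -> U \is unitarymx ->
  \sum_(i < k) lam`_i <= \tr (U *m A *m U^t*).
Proof.
move=> /orthomx_spectralP.
set P := spectralmx A; set d := spectral_diag A => A_eq lam_sorted chA Uu.
have Pu : P \is unitarymx := spectral_unitarymx A.
have size_lam : size lam = n.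
  apply/eqP; rewrite -eqSS -(size_char_poly A) chA.
  by rewrite size_prod_XsubC.
(* The spectral decomposition lists the eigenvalues in no particular order; comparing linear factors
   of [char_poly A] matches them with [lam] up to a permutation. *)
have perm_lam : perm_eq lam [tuple d 0 i | i < n].
  apply: prod_XsubC_eq; rewrite -chA {1}A_eq.
  rewrite char_poly_invmx_conj ?spectral_unit //.
  rewrite char_poly_trig ?diag_mx_is_trig // big_tuple.
  by apply: eq_bigr => i _; rewrite tnth_mktuple mxE eqxx mulr1n.
have [s lamE] := tuple_permP perm_lam.
pose V := U *m P^t*.
have Vu : V \is unitarymx by rewrite mul_unitarymx // trmxC_unitary.
have trE : \tr (U *m A *m U^t*) = \sum_j d 0 j * (V^t* *m V) j j.
  have -> : U *m A *m U^t* = V *m (diag_mx d *m V^t*).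
    rewrite {1}A_eq invmx_unitary // /V trmx_mul map_mxM trmxCK.
    by rewrite !mulmxA.
  rewrite mxtrace_mulC -mulmxA /mxtrace; apply: eq_bigr => j _.
  by rewrite mul_diag_mx mxE.
have le_kn : (k <= n)%N by rewrite -(mxrank_unitary Uu) rank_leq_col.
have lam_nth (i : 'I_n) : lam`_i = d 0 (s i).
  by rewrite lamE -tnth_nth !tnth_mktuple.
(* The index type becomes ['I_(size lam)], as in [sorted_weighted_sum]. *)
subst n.
rewrite trE (reindex_inj (@perm_inj _ s)) /=.
under [leRHS]eq_bigr do rewrite -lam_nth.
apply: sorted_weighted_sum => // [i|]; first exact: unitary_gram_diag_le1.
transitivity (\tr (V^t* *m V)).
  by rewrite /mxtrace [RHS](reindex_perm s).
by rewrite mxtrace_mulC (unitarymxP Vu) mxtrace1.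
Qed.

(** The embedding of [R] into [R[i]] preserves order, traces and characteristic polynomials, and it
    turns symmetric matrices into normal ones, so the complex case transfers. *)
Lemma ky_fan_real (R : rcfType) (k n : nat) (A : 'M[R]_n)
  (lam : seq R) (U : 'M[R]_(k, n)) :
  A^T = A -> sorted_eigenvalues A lam -> U *m U^T = 1%:M ->
  \sum_(i < k) lam`_i <= \tr (U *m A *m U^T).
Proof.
move=> A_sym [_ lam_sorted chA] UU.
pose f : {rmorphism R -> R[i]} := real_complex R.
have fconj m p (B : 'M[R]_(m, p)) : (map_mx f B) ^t* = map_mx f B^T.
  by apply/matrixP=> i j; rewrite !mxE; apply: conjc_real.
have fnormal : map_mx f A \is normalmx.
  by apply/normalmxP; rewrite fconj A_sym.
have fU : map_mx f U \is unitarymx.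
  by apply/unitarymxP; rewrite fconj -map_mxM UU map_mx1.
have f_sorted : sorted <=%R (map f lam).
  by rewrite sorted_map; apply: sub_sorted lam_sorted => x y; rewrite /= lecR.
have chf : char_poly (map_mx f A) = \prod_(x <- map f lam) ('X - x%:P).
  by rewrite prod_map_poly -map_char_poly chA.
have := ky_fan_normal fnormal f_sorted chf fU.
rewrite fconj -!map_mxM trace_map_mx.
have -> : \sum_(i < k) (map f lam)`_i = f (\sum_(i < k) lam`_i).
  rewrite rmorph_sum; apply: eq_bigr => i _.
  (* Past the end of [lam] both sides take the default value 0. *)
  have [lt_i|le_i] := ltnP i (size lam); first exact: nth_map.
  by rewrite !nth_default ?size_map ?rmorph0.
by rewrite lecR.
Qed.

(** * Input/output of a stretch of an evaluation *)

Local Close Scope ring_scope.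

Lemma sum_le_card (T : finType) (P : pred T) (X : {set T}) (F : T -> nat) c :
  (forall x, P x -> F x <= c * (x \in X)) -> \sum_(x | P x) F x <= c * #|X|.
Proof.
move=> le_F; apply: (@leq_trans (\sum_(x | P x) c * (x \in X))).
  exact: leq_sum.
rewrite -big_distrr leq_mul2l -sum1_card big_mkcond [leqRHS]big_mkcond /=.
by rewrite leq_sum ?orbT // => x _; case: (P x) (x \in X) => [] [].
Qed.

Section Pebbling.

Variables (n : nat) (e : rel 'I_n) (M : nat).
Implicit Types (s : pstate n) (ms : seq (move n)) (S : {set 'I_n}).

Definition operands S := [set u | (u \notin S) && [exists v in S, e u v]].
Definition results S := [set u in S | [exists v, (v \notin S) && e u v]].
(** Vertices are counted, not edges: one transfer can serve several consumers. The factor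
    [max_dout e] later converts vertices into edges. *)
Definition boundary S := #|operands S| + #|results S|.

(** Being a set, it counts repeated transfers of a value once, which is enough for a lower bound on
    the cost. *)
Definition reads ms :=
  [set v | has (fun m => if m is Read w then w == v else false) ms].
Definition writes ms :=
  [set v | has (fun m => if m is Write w then w == v else false) ms].

(** Invariant of a run. The bound on [fast s] yields the [M] lost at each end of a stretch; closure
    under predecessors says that consumers come after their operands. *)
Definition consistent s :=
  [/\ fast s \subset done_ s, slow s \subset done_ s, #|fast s| <= M &
      forall u v, e u v -> v \in done_ s -> u \in done_ s].

Lemma reads_cons m ms :
  reads (m :: ms) = (if m is Read w then [set w] else set0) :|: reads ms.
Proof. by apply/setP=> v; rewrite !inE; case: m => w; rewrite !inE // eq_sym. Qed.

Lemma writes_cons m ms :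
  writes (m :: ms) = (if m is Write w then [set w] else set0) :|: writes ms.
Proof. by apply/setP=> v; rewrite !inE; case: m => w; rewrite !inE // eq_sym. Qed.

Lemma card_reads_writes ms : #|reads ms| + #|writes ms| <= io_cost ms.
Proof.
elim: ms => [|m ms IH].
  have -> : reads [::] = set0 by apply/setP=> v; rewrite !inE.
  have -> : writes [::] = set0 by apply/setP=> v; rewrite !inE.
  by rewrite cards0.
rewrite reads_cons writes_cons -[io_cost (m :: ms)]/(is_io m + io_cost ms).
case: m => w /=; rewrite ?set0U ?add0n // ?setU0 cardsU1.
  by rewrite -addnA leq_add // leq_b1.
by rewrite addnCA leq_add // leq_b1.
Qed.

Lemma step_consistent s m s' :
  consistent s -> step e M s m = Some s' -> consistent s'.
Proof.
move=> [fd sd fM ed]; case: m => v /=; case: ifP => // H [<-]; split=> //=.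
- exact: setUS.
- exact: subset_trans sd (subsetUr _ _).
- by case/andP: H.
- move=> u w euw; rewrite !inE => /orP[/eqP wv|wd]; last first.
    by rewrite (ed u w) ?orbT.
  case/andP: H => /andP[_ /forallP/(_ u)]; rewrite -wv euw /= => uf _.
  by rewrite (subsetP fd) ?orbT.
- by rewrite subUset sub1set fd andbT (subsetP sd) //; case/andP: H.
- by case/andP: H.
- by rewrite subUset sub1set sd andbT (subsetP fd).
- exact: subset_trans (subD1set _ _) fd.
- exact: leq_trans (subset_leq_card (subD1set _ _)) fM.
Qed.

Lemma run_consistent s ms s' :
  consistent s -> run e M s ms = Some s' -> consistent s'.
Proof.
elim: ms s => [|m ms IH] s cs /=; first by move=> [<-].
by case E: step => [s1|//]; apply: IH (step_consistent cs E).
Qed.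

Lemma step_done_sub s m s' : step e M s m = Some s' -> done_ s \subset done_ s'.
Proof. by case: m => v /=; case: ifP => // _ [<-] //=; apply: subsetUr. Qed.

Lemma run_done_sub s ms s' : run e M s ms = Some s' -> done_ s \subset done_ s'.
Proof.
elim: ms s => [|m ms IH] s /=; first by move=> [<-].
by case E: step => [s1|//] /IH; apply: subset_trans (step_done_sub E).
Qed.

Lemma step_operand s m s' u v :
  step e M s m = Some s' -> v \in done_ s' -> v \notin done_ s -> e u v ->
  u \in fast s.
Proof.
case: m => w /=; case: ifP => // H [<-] /=; try by move=> ->.
rewrite !inE => /orP[/eqP->|->] // _ ewv.
by case/andP: H => /andP[_ /forallP/(_ u)]; rewrite ewv.
Qed.

Lemma step_fast s m s' u :
  step e M s m = Some s' -> u \in fast s' ->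
  [|| u \in fast s, u \in reads [:: m] | u \in done_ s' :\: done_ s].
Proof.
case: m => w /=; case: ifP => // H [<-] /=; rewrite !inE.
- case/andP: H => /andP[wd _] _.
  by case/orP => [/eqP->|->] //; rewrite wd eqxx !orbT.
- by case/orP => [/eqP->|->] //=; rewrite eqxx !orbT.
- by move->.
- by case/andP=> _ ->.
Qed.

(** When [v] is computed, [u] is in fast memory. Tracing [u] backwards, it was there from the start,
    or was read, or was computed on the way. *)
Lemma run_operand s ms s' u v :
  run e M s ms = Some s' -> v \in done_ s' -> v \notin done_ s -> e u v ->
  [|| u \in fast s, u \in reads ms | u \in done_ s' :\: done_ s].
Proof.
move=> H vs' + euv; elim: ms s H => [|m ms IH] s /=.
  by move=> [->]; rewrite vs'.
case E: step => [s1|//] H vs; have [vs1|vs1] := boolP (v \in done_ s1).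
  by rewrite (step_operand E vs1 vs euv).
have /subsetP ss1 := step_done_sub E; have /subsetP s1s' := run_done_sub H.
rewrite reads_cons; have := IH s1 H vs1; rewrite !inE.
case/or3P => [/(step_fast E)|->|/andP[us1 ->]]; last first.
- by rewrite (contra (ss1 u) us1) !orbT.
- by rewrite !orbT.
rewrite reads_cons !inE orbF.
by case/or3P => [->|->|/andP[-> /s1s' ->]]; rewrite ?orbT.
Qed.

Lemma run_slow s ms s' :
  run e M s ms = Some s' -> slow s' \subset slow s :|: writes ms.
Proof.
elim: ms s => [|m ms IH] s /=; first by move=> [->]; apply: subsetUl.
case E: step => [s1|//] /IH/subset_trans; apply.
rewrite writes_cons setUA setSU //.
by case: m E => w /=; case: ifP => // _ [<-] /=; rewrite ?subsetUl // setUC.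
Qed.

(** Without recomputation, a computed value absent from both memories can never come back. *)
Lemma step_lost s m s' u :
  step e M s m = Some s' -> u \in done_ s -> u \notin fast s :|: slow s ->
  u \notin fast s' :|: slow s'.
Proof.
case: m => w /=; case: ifP => // H [<-] /=; rewrite !inE => ud.
- case: eqP => [uw|//]; by move: H; rewrite -uw ud.
- by case: eqP => [->|//]; case/andP: H => ->; rewrite orbT.
- by case: eqP => [->|//]; rewrite H.
- by rewrite !negb_or negb_and => /andP[-> ->]; rewrite orbT.
Qed.

(** A lost value stays lost by [step_lost], so it could not be in fast memory when [v] is
    computed. *)
Lemma run_needed s ms s' u v :
  run e M s ms = Some s' -> u \in done_ s -> v \in done_ s' ->
  v \notin done_ s -> e u v -> u \in fast s :|: slow s.
Proof.
move=> + + vs' + euv; elim: ms s => [|m ms IH] s /=.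
  by move=> [->]; rewrite vs'.
case E: step => [s1|//] H us vs; have [vs1|vs1] := boolP (v \in done_ s1).
  by rewrite inE (step_operand E vs1 vs euv).
have /subsetP ss1 := step_done_sub E.
by apply: contraLR (IH s1 H (ss1 u us) vs1); apply: step_lost E us.
Qed.

Lemma segment_io s ms s1 ms' s' :
  consistent s -> run e M s ms = Some s1 -> run e M s1 ms' = Some s' ->
  done_ s' = setT -> boundary (done_ s1 :\: done_ s) <= io_cost ms + 2 * M.
Proof.
move=> cs run1 run2 done_all; set S := done_ s1 :\: done_ s.
have [_ sd fM ed] := cs; have [_ _ fM1 _] := run_consistent cs run1.
have opS : operands S \subset fast s :|: reads ms.
  apply/subsetP=> u; rewrite inE => /andP[uS /exists_inP[v]].
  rewrite inE => /andP[vs vs1] euv; have := run_operand run1 vs1 vs euv.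
  by rewrite (negPf uS) orbF in_setU.
have resS : results S \subset fast s1 :|: writes ms.
  apply/subsetP=> u; rewrite !inE => /andP[/andP[us us1] /existsP[v]].
  (* A consumer of [u] outside [S] is not in [done_ s], by closure under predecessors, so it is
     computed after [s1] and [run_needed] applies. *)
  rewrite !inE negb_and negbK => /andP[/orP[vs|vs1] euv].
    by rewrite (ed u v euv vs) in us.
  have := run_needed run2 us1 _ vs1 euv; rewrite done_all !inE => /(_ isT).
  case/orP => [->//|/(subsetP (run_slow run1))]; rewrite inE.
  (* A value of [S] is not yet computed in [s], hence not in [slow s]: its slow copy was written
     during [ms]. *)
  by case/orP => [/(subsetP sd)|]; rewrite ?(negPf us) // inE => ->; rewrite orbT.
have op_le := leq_trans (subset_leq_card opS) (leq_card_setU _ _).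
have res_le := leq_trans (subset_leq_card resS) (leq_card_setU _ _).
apply: leq_trans (leq_add op_le res_le) _.
by rewrite addnACA addnC mul2n -addnn !leq_add ?card_reads_writes.
Qed.

(** A discrete intermediate value argument: each move enlarges [done_] by at most one vertex, so
    every intermediate cardinality is attained. *)
Lemma run_split_done s ms s' q :
  run e M s ms = Some s' -> #|done_ s| + q <= #|done_ s'| ->
  exists ms1 ms2 s1, [/\ ms = ms1 ++ ms2, run e M s ms1 = Some s1,
    run e M s1 ms2 = Some s' & #|done_ s1| = #|done_ s| + q].
Proof.
elim: ms s q => [|m ms IH] s q /=.
  by move=> [->] le_q; exists [::], [::], s'; split=> //;
     apply/eqP; rewrite eqn_leq le_q leq_addr.
case: q => [|q] H; first by exists [::], (m :: ms), s; rewrite addn0; split.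
move: H; case E: step => [s1|//] H le_q.
have le1 : #|done_ s1| <= #|done_ s|.+1.
  case: m E => w /=; case: ifP => // _ [<-] //=.
  by rewrite cardsU1; case: (_ \notin _).
have le2 : #|done_ s1| <= #|done_ s| + q.+1.
  by apply: leq_trans le1 _; rewrite addnS ltnS leq_addr.
have [|ms1 [ms2 [s2 [-> run1 run2 card2]]]] :=
  IH s1 (#|done_ s| + q.+1 - #|done_ s1|) H; first by rewrite subnKC.
by exists (m :: ms1), ms2, s2; split=> //=; rewrite ?E // card2 subnKC.
Qed.

(** Disjointness from [done_ s] strengthens the induction: it separates the later stretches from the
    one just cut off. Moves after the last stretch can only add cost. *)
Lemma run_segments k q s ms s' :
  consistent s -> run e M s ms = Some s' -> done_ s' = setT ->
  #|done_ s| + k * q <= n ->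
  exists Ss : seq {set 'I_n},
    [/\ size Ss = k, pairwise (fun A B : {set 'I_n} => [disjoint A & B]) Ss,
        all (fun A : {set 'I_n} => (#|A| == q) && [disjoint done_ s & A]) Ss &
        \sum_(A <- Ss) boundary A <= io_cost ms + 2 * k * M].
Proof.
elim: k s ms => [|k IH] s ms cs runs done_all le_n.
  by exists [::]; split=> //; rewrite big_nil.
have [|ms1 [ms2 [s1 [-> run1 run2 card1]]]] := run_split_done (q := q) runs.
  by rewrite done_all cardsT card_ord (leq_trans _ le_n) //
     leq_add2l mulSn leq_addr.
have sub1 := run_done_sub run1.
have [|Ss [size_Ss pwSs /allP allSs sumSs]] :=
  IH s1 ms2 (run_consistent cs run1) run2 done_all.
  by rewrite card1 -addnA -mulSn.
exists (done_ s1 :\: done_ s :: Ss); split=> /=.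
- by rewrite size_Ss.
- rewrite pwSs andbT; apply/allP=> A /allSs /andP[_].
  exact/disjointWl/subsetDl.
- apply/andP; split; last first.
    by apply/allP=> A /allSs /andP[-> /=]; apply: disjointWl.
  rewrite cardsD (setIidPr sub1) card1 addKn eqxx /=.
  by rewrite -setI_eq0 setIDA setIC setDIl setDv ?set0I ?setI0.
- rewrite big_cons /io_cost count_cat -!/(io_cost _).
  rewrite mulnS mulnDl addnACA; apply: leq_add sumSs.
  exact: segment_io cs run1 run2 done_all.
Qed.

Lemma init_consistent : consistent (init_state n).
Proof. by split; rewrite /= ?cards0 // => u v _; rewrite inE. Qed.

(** Each edge crossing the cut is charged to its tail, which lies in [operands] if the edge enters
    [S] and in [results] if it leaves [S]. *)
Lemma edge_cut_le S :
  \sum_(u in S) #|[set v | uadj e u v && (v \notin S)]| <=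
  max_dout e * boundary S.
Proof.
pose out (u : 'I_n) (B : pred 'I_n) := #|[set v | e u v && B v]|.
have out_le u (B : pred _) (X : {set 'I_n}) :
    (forall v, e u v -> B v -> u \in X) -> out u B <= max_dout e * (u \in X).
  move=> BX; have [_|uX] := boolP (u \in X); rewrite ?muln1 ?muln0.
    apply: leq_trans (leq_bigmax u); apply: subset_leq_card.
    by apply/subsetP=> v; rewrite !inE => /andP[].
  rewrite leqn0 cards_eq0; apply/eqP/setP=> v; rewrite !inE.
  by apply: contraNF uX => /andP[]; apply: BX.
have split_le : \sum_(u in S) #|[set v | uadj e u v && (v \notin S)]| <=
    \sum_(u in S) #|[set v | e v u && (v \notin S)]| +
    \sum_(u in S) out u (fun v => v \notin S).
  rewrite -big_split /=; apply: leq_sum => u _.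
  apply: leq_trans (leq_card_setU _ _); apply: subset_leq_card.
  apply/subsetP=> v; rewrite !inE => /andP[/andP[_ euv] ->].
  by rewrite !andbT orbC.
apply: leq_trans split_le _; rewrite mulnDr; apply: leq_add.
  (* Entering edges are regrouped by tail, since only out-degrees are bounded. *)
  have -> : \sum_(u in S) #|[set v | e v u && (v \notin S)]| =
            \sum_(v | v \notin S) out v (fun u => u \in S).
    under eq_bigr do rewrite -sum1dep_card.
    rewrite (exchange_big_dep (fun v => v \notin S)) /=; last first.
      by move=> ? ? _ /andP[].
    apply: eq_bigr => v vS; rewrite /out -sum1dep_card.
    by apply: eq_bigl => u; rewrite vS andbT andbC.
  apply: sum_le_card => v vS; apply: out_le => u evu uS.
  by rewrite inE vS; apply/exists_inP; exists u.
apply: sum_le_card => u uS; apply: out_le => v euv vS.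
by rewrite inE uS; apply/existsP; exists v; rewrite vS.
Qed.

End Pebbling.

Local Open Scope ring_scope.

(** * Quadratic form of the Laplacian *)

Lemma laplacian_sym (R : nzRingType) (n : nat) (e : rel 'I_n) :
  (laplacian R e)^T = laplacian R e.
Proof.
apply/matrixP=> i j; rewrite !mxE /uadj orbC (eq_sym j i) eq_sym.
by case: eqP => [->|].
Qed.

(** The degree of [i] minus its neighbours in [S] leaves its neighbours outside [S]. *)
Lemma laplacian_row_sum (R : nzRingType) (n : nat) (e : rel 'I_n)
  (S : {set 'I_n}) (i : 'I_n) : i \in S ->
  \sum_(j in S) laplacian R e i j = #|[set j | uadj e i j && (j \notin S)]|%:R.
Proof.
move=> iS; under eq_bigr do rewrite mxE; rewrite sumrB.
rewrite (bigD1 i) //= eqxx big1 => [|j /andP[_ /negPf]]; last first.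
  by rewrite eq_sym => ->.
rewrite addr0 -big_mkcondr /= sumr_const.
have -> : udeg e i = (#|[set j | uadj e i j && (j \notin S)]| +
                      #|[set j | (j \in S) && uadj e i j]|)%N.
  rewrite /udeg -[LHS](cardsID S) addnC; congr (_ + _)%N; apply: eq_card => j.
    by rewrite !inE andbC.
  by rewrite !inE andbC.
by rewrite natrD [X in _ + X%:R]cardsE addrK.
Qed.

Definition indicator_mx (R : rcfType) (n q : nat) (Ss : seq {set 'I_n}) :
  'M[R]_(size Ss, n) :=
  \matrix_(i, v) ((v \in nth set0 Ss i)%:R / Num.sqrt q%:R).

Section IndicatorMatrix.

Variables (R : rcfType) (n q : nat) (Ss : seq {set 'I_n}).
Local Notation U := (indicator_mx R q Ss).

(** The square roots occur only in pairs, so later computations see just [q%:R^-1]. *)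
Lemma indicator_mx_entry_mul i u j v :
  U i u * U j v =
  q%:R^-1 * ((u \in nth set0 Ss i) && (v \in nth set0 Ss j))%:R.
Proof.
rewrite !mxE mulrACA -invfM -expr2 sqr_sqrtr ?ler0n // mulrC -natrM.
by rewrite mulnb.
Qed.

Lemma indicator_mx_orthonormal :
  (0 < q)%N -> all (fun A : {set 'I_n} => #|A| == q) Ss ->
  pairwise (fun A B : {set 'I_n} => [disjoint A & B]) Ss -> U *m U^T = 1%:M.
Proof.
move=> q_gt0 cardSs disjSs; apply/matrixP=> i j; rewrite !mxE.
have entry v : U i v * U^T v j =
    q%:R^-1 * ((v \in nth set0 Ss i) && (v \in nth set0 Ss j))%:R.
  by rewrite [U^T v j]mxE indicator_mx_entry_mul.
under eq_bigr do rewrite entry.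
have -> : \sum_v q%:R^-1 * ((v \in nth set0 Ss i) && (v \in nth set0 Ss j))%:R =
    q%:R^-1 * #|nth set0 Ss i :&: nth set0 Ss j|%:R :> R.
  rewrite -mulr_sumr -natr_sum -sum1_card [in RHS]big_mkcond /=.
  by congr (_ * _%:R); apply: eq_bigr => v _; rewrite !inE; case: andb.
have disj (x y : 'I_(size Ss)) : (x < y)%N ->
    nth set0 Ss x :&: nth set0 Ss y = set0.
  move=> lt_xy; apply/eqP; rewrite setI_eq0.
  by move/(pairwiseP set0): disjSs; apply; rewrite ?inE.
have [-> | ne_ij] := eqVneq i j.
  rewrite setIid (eqP (all_nthP set0 cardSs j _)) //.
  by rewrite mulVf // pnatr_eq0 -lt0n.
suff -> : nth set0 Ss i :&: nth set0 Ss j = set0 by rewrite cards0 mulr0.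
move: ne_ij; rewrite -val_eqE neq_ltn => /orP[|lt_ji]; first exact: disj.
by rewrite setIC disj.
Qed.

(** Each diagonal entry is a quadratic form at a scaled indicator vector, evaluated by summing the
    rows of the Laplacian indexed by [A] over [A]. *)
Lemma indicator_mx_trace (e : rel 'I_n) :
  \tr (U *m laplacian R e *m U^T) =
  q%:R^-1 * (\sum_(A <- Ss) \sum_(u in A)
               #|[set v | uadj e u v && (v \notin A)]|)%N%:R.
Proof.
rewrite (big_nth set0) big_mkord natr_sum mulr_sumr; apply: eq_bigr => i _.
set A := nth set0 Ss i; rewrite mxE.
under [LHS]eq_bigr do rewrite mxE mulr_suml.
rewrite exchange_big /= natr_sum mulr_sumr [RHS]big_mkcond /=.
apply: eq_bigr => u _; case: ifP => [uA|uA]; last first.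
  by apply: big1 => v _; rewrite !mxE -/A uA !mul0r.
rewrite -(laplacian_row_sum R e uA) mulr_sumr [RHS]big_mkcond /=.
apply: eq_bigr => v _; rewrite [U^T v i]mxE mulrAC indicator_mx_entry_mul uA /=.
by rewrite -/A; case: (v \in A); rewrite ?mulr1 ?mulr0 ?mul0r.
Qed.

End IndicatorMatrix.

Theorem theorem4p5 (R : rcfType) (n : nat) (e : rel 'I_n) (M : nat)
  (lam : seq R) (k : nat) :
  acyclic e -> has_edge e ->
  sorted_eigenvalues (laplacian R e) lam ->
  (1 <= k)%N -> (k <= n)%N ->
  forall ms : seq (move n), valid_evaluation e M ms ->
    (io_cost ms)%:R >=
      (max_dout e)%:R^-1 * (n %/ k)%:R * (\sum_(i < k) lam`_i)
      - 2%:R * k%:R * M%:R.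
Proof.
move=> _ _ lamP k_gt0 le_kn ms [s [run_ms done_all]].
have q_gt0 : (0 < n %/ k)%N by rewrite divn_gt0.
have [|Ss [size_Ss disjSs cardSs sumSs]] :=
  run_segments (q := n %/ k) (k := k) (init_consistent e M) run_ms done_all.
  by rewrite cards0 mulnC leq_divM.
have {}cardSs : all (fun A : {set 'I_n} => #|A| == (n %/ k)%N) Ss.
  by apply: sub_all cardSs => A /andP[].
have := ky_fan_real (laplacian_sym R e) lamP
  (indicator_mx_orthonormal R q_gt0 cardSs disjSs).
(* The normalising factor [q%:R^-1] moves across and becomes the factor [n %/ k] of the bound. *)
rewrite indicator_mx_trace size_Ss mulrC ler_pdivlMr ?ltr0n // mulrC => spectral.
set d := max_dout e.
have cut_le : (n %/ k)%:R * (\sum_(i < k) lam`_i) <=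
    (d * (io_cost ms + 2 * k * M))%:R.
  apply: le_trans spectral _; rewrite ler_nat.
  apply: leq_trans (_ : _ <= d * \sum_(A <- Ss) boundary e A)%N _.
    by rewrite big_distrr /= leq_sum // => A _; apply: edge_cut_le.
  by rewrite leq_mul2l sumSs orbT.
rewrite lerBlDr -mulrA -!natrM -natrD.
(* For [d = 0] the inverse is 0 by convention and the left side vanishes; otherwise the denominator
   is cleared. *)
have [-> | d_gt0] := posnP d; first by rewrite invr0 mul0r ler0n.
by rewrite ler_pdivrMl ?ltr0n // -natrM.
Qed.
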